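(* Let $\alpha=(\alpha_1,\alpha_2,\ldots,\alpha_s)$ be a composition and $r(\alpha)$ the rank sequence of the lattice of lower order ideals of the fence poset $F(\alpha)$. (a) If $s=1$ then $r(\alpha)=(1,1,\ldots,1)$ is symmetric. (b) If $s$ is even, then $r(\alpha)$ is bottom interlacing. (c) If $s\ge 3$ is odd: (i) if $\alpha_1>\alpha_s$ then $r(\alpha)$ is bottom interlacing; (ii) if $\alpha_1<\alpha_s$ then $r(\alpha)$ is top interlacing; (iii) if $\alpha_1=\alpha_s$ then $r(\alpha)$ is symmetric, bottom interlacing, or top interlacing according as $r(\alpha_2,\alpha_3,\ldots,\alpha_{s-1})$ is symmetric, top interlacing, or bottom interlacing, respectively.
   Context: A composition $\alpha=(\alpha_1,\ldots,\alpha_s)$ of $n$ is a sequence of positive integers with sum $n$. The fence poset $F(\alpha)$ is the poset on $x_1,\ldots,x_{n+1}$ generated by the relations $x_1\preceq x_2\preceq\cdots\preceq x_{\alpha_1+1}\succeq x_{\alpha_1+2}\succeq\cdots\succeq x_{\alpha_1+\alpha_2+1}\preceq\cdots$ (the first $\alpha_1$ steps up, the next $\alpha_2$ down, alternately). The rank sequence $r(\alpha)=(r_0,\ldots,r_{n+1})$ has $r_k$ = number of lower order ideals of $F(\alpha)$ with $k$ elements. For a sequence $(a_0,\ldots,a_m)$: it is symmetric if $a_k=a_{m-k}$ for all $k$; it is top interlacing if $a_0\le a_m\le a_1\le a_{m-1}\le a_2\le\cdots\le a_{\lceil m/2\rceil}$; it is bottom interlacing if $a_m\le a_0\le a_{m-1}\le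 a_1\le\cdots\le a_{\lfloor m/2\rfloor}$. *)

(* Defs.v *)
From HB Require Import structures.
From mathcomp Require Import all_boot all_order.

Set Implicit Arguments.
Unset Strict Implicit.
Unset Printing Implicit Defensive.

Import Order.TTheory.

Definition is_composition (alpha : seq nat) : bool := all (ltn 0) alpha.

(* The directions of the sumn alpha steps of the fence, [true] meaning up. *)
Fixpoint steps_from (up : bool) (alpha : seq nat) : seq bool :=
  if alpha is a :: alpha' then nseq a up ++ steps_from (~~ up) alpha'
  else [::].

Definition fence_steps (alpha : seq nat) : seq bool := steps_from true alpha.

(* The element i : 'I_n.+1 stands for x_(i+1), and step i joins x_(i+1) to
   x_(i+2).  The alias hides the usual order of the ordinals. *)
Definition fence (alpha : seq nat) : Type := 'I_(sumn alpha).+1.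

HB.instance Definition _ alpha := Finite.on (fence alpha).

Definition fence_gen (alpha : seq nat) : rel (fence alpha) :=
  fun x y : 'I_(sumn alpha).+1 =>
       (y == x.+1 :> nat) && nth true (fence_steps alpha) x
    || (x == y.+1 :> nat) && ~~ nth true (fence_steps alpha) y.

Definition fence_le (alpha : seq nat) : rel (fence alpha) :=
  connect (@fence_gen alpha).

Section FencePoset.

Variable alpha : seq nat.

Lemma size_steps_from up s : size (steps_from up s) = sumn s.
Proof. by elim: s up => //= a s IHs up; rewrite size_cat size_nseq IHs. Qed.

Let height (i : nat) : nat :=
  count id (take i (fence_steps alpha)) +
  count negb (drop i (fence_steps alpha)).

Let heightS i : i < sumn alpha ->
  (if nth true (fence_steps alpha) i then height i < height i.+1
   else height i.+1 < height i).
Proof.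
rewrite -(size_steps_from true) => lti.
rewrite /height (take_nth true lti) (drop_nth true lti) -cats1 count_cat /=.
by case: (nth _ _ i); rewrite /= !(addn0, addn1, add0n, add1n, addnS, addSn).
Qed.

Let fence_gen_height (x y : fence alpha) :
  fence_gen x y ->
  height (x : 'I_(sumn alpha).+1) < height (y : 'I_(sumn alpha).+1).
Proof.
move: x y => [x ltx] [y lty] /orP[] /andP[/= /eqP def st].
  by rewrite def in lty *; have := heightS lty; rewrite st.
by rewrite def in ltx *; have := heightS ltx; rewrite (negPf st).
Qed.

Let fence_le_height (x y : fence alpha) : fence_le x y ->
  x = y \/ height (x : 'I_(sumn alpha).+1) < height (y : 'I_(sumn alpha).+1).
Proof.
move=> /connectP[p + ->{y}]; elim: p x => [|z p IHp] x /=; first by left.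
move=> /andP[/fence_gen_height lt_xz /IHp[<-|lt_z]]; right=> //.
exact: ltn_trans lt_xz lt_z.
Qed.

Lemma fence_le_refl : reflexive (@fence_le alpha).
Proof. exact: connect0. Qed.

Lemma fence_le_anti : antisymmetric (@fence_le alpha).
Proof.
move=> x y /andP[/fence_le_height[//|lt_xy] /fence_le_height[//|lt_yx]].
by have := ltn_trans lt_xy lt_yx; rewrite ltnn.
Qed.

Lemma fence_le_trans : transitive (@fence_le alpha).
Proof. exact: connect_trans. Qed.

End FencePoset.

Fact fence_display : Order.disp_t. Proof. exact: Order.Disp tt tt. Qed.

HB.instance Definition _ alpha :=
  Order.Le_isPOrder.Build fence_display (fence alpha)
    (@fence_le_refl alpha) (@fence_le_anti alpha) (@fence_le_trans alpha).

Definition lower_ideal (d : Order.disp_t) (T : finPOrderType d)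
    (I : {set T}) : bool :=
  [forall x in I, forall y : T, (y <= x)%O ==> (y \in I)].

Definition ideal_count (d : Order.disp_t) (T : finPOrderType d)
    (k : nat) : nat :=
  #|[set I : {set T} | lower_ideal I & #|I| == k]|.

(* r(alpha) = (r_0, ..., r_(n+1)): it has n + 2 terms, n = sumn alpha. *)
Definition rank_seq (alpha : seq nat) : seq nat :=
  mkseq (ideal_count (fence alpha)) (sumn alpha).+2.

(* In the next three definitions the sequence is (a_0, ..., a_m). *)
Definition symmetric_seq (a : seq nat) : Prop :=
  let m := (size a).-1 in
  forall k, k <= m -> nth 0 a k = nth 0 a (m - k).

(* a_0 <= a_m <= a_1 <= a_(m-1) <= ..., the chain having m + 1 terms; its last
   term is then a_(m/2) for m even and a_((m+1)/2) for m odd. *)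
Definition top_interlacing (a : seq nat) : bool :=
  let m := (size a).-1 in
  sorted leq (mkseq (fun j => nth 0 a (if odd j then m - j./2 else j./2)) m.+1).

(* a_m <= a_0 <= a_(m-1) <= a_1 <= ..., the chain having m + 1 terms; its last
   term is then a_(m/2) for m even and a_((m-1)/2) for m odd. *)
Definition bottom_interlacing (a : seq nat) : bool :=
  let m := (size a).-1 in
  sorted leq (mkseq (fun j => nth 0 a (if odd j then j./2 else m - j./2)) m.+1).

(* (alpha_2, ..., alpha_(s-1)) *)
Definition inner_parts (alpha : seq nat) : seq nat :=
  take (size alpha - 2) (drop 1 alpha).

(* Main.v *)
Require Import Defs.
From mathcomp Require Import all_boot all_order all_algebra.
From mathcomp Require Import zify.

(* Number ideals of a fence by a transfer matrix product: an up step is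
   U = [[1, 0], [1, q]] and a down step D = [[1, q], [0, q]], indexed by the
   membership of the two ends.  The trace of a word in two 2x2 matrices does not
   change when the word is reversed; since complementing ideals reverses the
   order and exchanges U and D, this says that the rank polynomials of circular
   fences are palindromic.  Closing up a fence with N elements into circular
   ones yields two identities for its rank numbers r_k, in terms of the numbers
   f_xy(k) of k-element ideals whose membership at the two ends is x and y:
     r_i - r_(N-i) = f_01(i) - f_01(N-i),
     r_i - r_(N-1-i) = f_00(N-i) - f_00(i+1).
   The polynomials f_xy are, up to a power of q, rank polynomials of shorter
   fences, which are unimodal around their centre by induction; this gives all
   the inequalities r_i <= r_(N-1-i), and their duals r_i >= r_(N+1-i).  For the
   word U^a m U^b, where m starts and ends with D, f_01 has centre displaced by
   (b - a)/2 from that of r, so the comparison of r_i with r_(N-i) is decided by the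
   sign of a - b, and by m when a = b. *)

Import Order.TTheory GRing.Theory.

Set Implicit Arguments.
Unset Strict Implicit.
Unset Printing Implicit Defensive.

(** * Ideal counts of step words, refined by the ends *)

Section Words.
Local Open Scope ring_scope.
Implicit Types (w v m : seq bool) (b c u : bool) (i j k t : int).

(* The number of k-element ideals of the fence with steps w, where b and c tell
   whether its first and last elements belong to the ideal.  The index k ranges
   over int, so that multiplication by q is a shift without boundary cases. *)
Fixpoint end_count w b c k : nat :=
  if w is u :: w' then
    let k' := if b then k - 1 else k in
    if b == u then (end_count w' false c k' + end_count w' true c k')%N
    else end_count w' b c k'
  else (b == c) && (k == if b then 1 else 0).

Definition word_count w k : nat :=
  (end_count w false false k + end_count w false true k +
   end_count w true false k + end_count w true true k)%N.

Lemma end_count_rcons w u b c k :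
  end_count (rcons w u) b c k =
  let k' := if c then k - 1 else k in
  if c == u then end_count w b c k'
  else (end_count w b false k' + end_count w b true k')%N.
Proof.
elim: w b k => [|u' w IHw] b k /=; last first.
  by rewrite !IHw {IHw} /=; case: b u' c u => [] [] [] [] //=; lia.
by case: b c u => [] [] [] /=; lia.
Qed.

(** The complement of an ideal is an ideal of the dual fence; reading that fence backwards restores
    the directions of the steps and reverses their order. *)
Lemma end_count_rev w b c k :
  end_count (rev w) (~~ c) (~~ b) ((size w).+1%:Z - k) = end_count w b c k.
Proof.
elim: w b k => [|u w IHw] b k; first by case: b c => [] [] //=; lia.
rewrite rev_cons end_count_rcons /= -!IHw.
have -> : (size w).+2%:Z - k - 1 = (size w).+1%:Z - k by lia.
have -> : (size w).+2%:Z - k = (size w).+1%:Z - (k - 1) by lia.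
by case: b u => [] [] //=; lia.
Qed.

Lemma end_count_negb w b c k :
  end_count (map negb w) (~~ b) (~~ c) ((size w).+1%:Z - k) = end_count w b c k.
Proof.
elim: w b k => [|u w IHw] b k; first by case: b c => [] [] //=; lia.
rewrite /= -!IHw.
have -> : (size w).+2%:Z - k - 1 = (size w).+1%:Z - k by lia.
have -> : (size w).+2%:Z - k = (size w).+1%:Z - (k - 1) by lia.
by case: b u => [] [] //=; lia.
Qed.

Lemma word_count_rev w k :
  word_count (rev w) ((size w).+1%:Z - k) = word_count w k.
Proof.
rewrite /word_count -[end_count w _ _ _]end_count_rev.
rewrite -[end_count w false true _]end_count_rev.
rewrite -[end_count w true false _]end_count_rev.
by rewrite -[end_count w true true _]end_count_rev /=; lia.
Qed.

Lemma word_count_negb w k :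
  word_count (map negb w) ((size w).+1%:Z - k) = word_count w k.
Proof.
rewrite /word_count -[end_count w _ _ _]end_count_negb.
rewrite -[end_count w false true _]end_count_negb.
rewrite -[end_count w true false _]end_count_negb.
by rewrite -[end_count w true true _]end_count_negb /=; lia.
Qed.

(* tr W, tr (W U), tr (W D) and tr (W D U), where W is the transfer matrix of w,
   are invariant under reversal of the word.  The four are proved together: by
   Cayley-Hamilton they span all tr (W X), X a word in U and D. *)
Lemma trace_rev w : let v := rev w in
  [/\ forall k, (end_count w false false (k - 1) + end_count w true true k =
        end_count v false false (k - 1) + end_count v true true k)%N,
      forall k, (end_count w false false k + end_count w false true k +
                 end_count w true true k =
        end_count v false false k + end_count v false true k +
                 end_count v true true k)%N,
      forall k, (end_count w false false k + end_count w true false k +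
                 end_count w true true k =
        end_count v false false k + end_count v true false k +
                 end_count v true true k)%N
    & forall k, (word_count v k + end_count v true true (k - 1) =
        word_count w (k - 1) + end_count w false false k)%N].
Proof.
elim: w => [|u w [T1 T2 T3 T4]] /=.
  by rewrite /rev /word_count; split=> k /=; lia.
rewrite rev_cons; split=> k; rewrite /word_count !end_count_rcons;
  move: (T1 k) (T1 (k - 1)) (T2 k) (T2 (k - 1)) (T2 (k - 1 - 1))
    (T3 k) (T3 (k - 1)) (T3 (k - 1 - 1)) (T4 k) (T4 (k - 1));
  rewrite /word_count {T1 T2 T3 T4}; case: u => /=; lia.
Qed.

(** * Interlacing as comparisons at a fixed index sum *)

Definition lower_le t (f : int -> nat) : Prop :=
  forall i j, i < j -> i + j = t -> (f i <= f j)%N.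

Definition lower_ge t (f : int -> nat) : Prop :=
  forall i j, i < j -> i + j = t -> (f j <= f i)%N.

(* For the rank numbers of a fence with N elements, t = N is bottom interlacing
   and t = N + 1 is top interlacing. *)
Definition interlaced t (f : int -> nat) : Prop :=
  lower_le (t - 1) f /\ lower_ge t f.

(** Leaves the comparison at index sum exactly [t] open: that one decides between [interlaced t] and
    [interlaced (t + 1)]. *)
Definition near_symmetric t (f : int -> nat) : Prop :=
  (forall t', t < t' -> lower_ge t' f) /\ (forall t', t' < t -> lower_le t' f).

Section Interlaced.
Variables (t : int) (f : int -> nat).
Hypothesis f_t : interlaced t f.

(** Neighbours are compared through a reflected index: [f i <= f (t - 1 - i) <= f (i + 1)], at index
    sums [t - 1] and [t]. *)
Lemma interlaced_incr i j : i <= j -> j + j <= t -> (f i <= f j)%N.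
Proof.
case: f_t => fP fQ le_ij; have [n ->] : exists n : nat, j = i + n%:Z.
  by exists `|j - i|%N; lia.
elim: n {j le_ij} => [|n IHn] jt; first by rewrite addr0.
apply: leq_trans (IHn _) _; first by lia.
apply: (@leq_trans (f (t - 1 - (i + n%:Z)))); first by apply: fP; lia.
have [lt_jt|ge_jt] := boolP (i + n.+1%:Z < t - 1 - (i + n%:Z)).
  by apply: fQ; lia.
by rewrite (_ : t - 1 - (i + n%:Z) = i + n.+1%:Z); lia.
Qed.

Lemma interlaced_decr i j : i <= j -> t - 1 <= i + i -> (f j <= f i)%N.
Proof.
case: f_t => fP fQ le_ij it; have [n ->] : exists n : nat, j = i + n%:Z.
  by exists `|j - i|%N; lia.
elim: n {j le_ij} => [|n IHn]; first by rewrite addr0.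
apply: leq_trans IHn.
apply: (@leq_trans (f (t - (i + n.+1%:Z)))); first by apply: fQ; lia.
have [lt_jt|ge_jt] := boolP (t - (i + n.+1%:Z) < i + n%:Z).
  by apply: fP; lia.
by rewrite (_ : t - (i + n.+1%:Z) = i + n%:Z); lia.
Qed.

Lemma interlaced_le t' : t' < t -> lower_le t' f.
Proof.
move=> lt_t i j lt_ij def_t'.
have [le_jt|gt_jt] := boolP (j + j <= t); first by apply: interlaced_incr; lia.
apply: (@leq_trans (f (t - 1 - j))); first by apply: interlaced_incr; lia.
have [lt_jt|ge_jt] := boolP (t - 1 - j < j); first by apply: f_t.1; lia.
by rewrite (_ : t - 1 - j = j); lia.
Qed.

Lemma interlaced_ge t' : t <= t' -> lower_ge t' f.
Proof.
move=> lt_t i j lt_ij def_t'.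
have [le_it|gt_it] := boolP (t - 1 <= i + i).
  by apply: interlaced_decr; lia.
apply: (@leq_trans (f (t - i))); first by apply: interlaced_decr; lia.
by apply: f_t.2; lia.
Qed.

End Interlaced.

Lemma interlaced_near t f :
  interlaced t f \/ interlaced (t + 1) f -> near_symmetric t f.
Proof.
case=> f_t; split=> t' lt_t; by
  [apply: interlaced_ge f_t _ _; lia | apply: interlaced_le f_t _ _; lia].
Qed.

Lemma lower_le_flip t n f g :
  (forall k, f (n - k) = g k) -> lower_le t f -> lower_ge (n + n - t) g.
Proof. by move=> fg f_t i j lt_ij ijt; rewrite -!fg; apply: f_t; lia. Qed.

Lemma lower_ge_flip t n f g :
  (forall k, f (n - k) = g k) -> lower_ge t f -> lower_le (n + n - t) g.
Proof. by move=> fg f_t i j lt_ij ijt; rewrite -!fg; apply: f_t; lia. Qed.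

(** Closing the fence by a down step from its last element to its first rules out exactly the ideals
    with end membership 01; the trace tr (W D) counts the others. *)
Lemma word_count_center w i j : i + j = (size w).+1%:Z ->
  (word_count w i + end_count w false true j =
   word_count w j + end_count w false true i)%N.
Proof.
move=> ij; have [_ _ /(_ i) T _] := trace_rev w.
have := (end_count_rev w false false j, end_count_rev w true false j).
have := end_count_rev w true true j.
rewrite -ij addrK /= /word_count => e1 [e2 e3]; lia.
Qed.

(** Here tr (W D U) closes the circle by an extra element below both ends: if it is in, the rest is
    any ideal with one element fewer; if it is out, so are both ends. *)
Lemma word_count_below w i j : i + j = (size w)%:Z ->
  (word_count w i + end_count w false false (i + 1) =
   word_count w j + end_count w false false (j + 1))%N.
Proof.
move=> ij; have [_ _ _ /(_ (i + 1))] := trace_rev w.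
rewrite addrK -(word_count_rev w j) -(end_count_rev w false false (j + 1)) /=.
have -> : (size w).+1%:Z - j = i + 1 by lia.
by have -> : (size w).+1%:Z - (j + 1) = i by lia.
Qed.

(** Everything above an excluded element is excluded. Dually, a final up run below an included
    element is forced in, so the 01 count of a padded word depends only on its core, up to a
    shift. *)
Lemma end_count_nseq a m c k :
  end_count (nseq a true ++ m) false c k = end_count m false c k.
Proof. by elim: a. Qed.

Lemma end_count_cat_nseq (b : nat) m c k :
  end_count (m ++ nseq b true) c true k = end_count m c true (k - b%:Z).
Proof.
elim: b k => [|b IHb] k; first by rewrite cats0 subr0.
rewrite -addn1 nseqD catA cats1 end_count_rcons /= IHb.
by congr end_count; lia.
Qed.

Definition fence_near w := near_symmetric (size w).+1%:Z (word_count w).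

(** * Consequences of unimodality for shorter words *)

Section Step.
Variable n : nat.
Hypothesis IHn : forall w, (size w < n)%N -> fence_near w.

(** As the last element is out, trailing down steps only strip excluded elements, and an up step
    before them leaves a shorter fence without constraint, to which [IHn] applies. *)
Lemma end_count_sum0_ge w t : (size w <= n)%N -> (size w)%:Z < t ->
  lower_ge t (fun k => end_count w false false k + end_count w true false k)%N.
Proof.
elim/last_ind: w => [|w u IHw]; first by move=> _ t0 i j /=; lia.
rewrite size_rcons => lt_wn lt_wt i j lt_ij ij.
rewrite !end_count_rcons; case: u => /=; last by apply: IHw; lia.
have := (IHn lt_wn).1 _ lt_wt i j lt_ij ij; rewrite /word_count; lia.
Qed.

Lemma end_count00_ge w t : (size w <= n)%N -> (size w)%:Z < t ->
  lower_ge t (end_count w false false).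
Proof.
elim: w => [|u w IHw] /= lt_wn lt_wt i j lt_ij ij; first by lia.
case: u; first by apply: IHw; lia.
by apply: (@end_count_sum0_ge w t); lia.
Qed.

(** The shifted arguments in [word_count_below] sum to [size w + 2], where the 00 count is already
    decreasing. *)
Lemma word_count_le w : (size w <= n)%N ->
  lower_le (size w)%:Z (word_count w).
Proof.
move=> le_wn i j lt_ij ij; have := word_count_below ij.
suff : (end_count w false false (j + 1) <= end_count w false false (i + 1))%N.
  by lia.
by apply: (@end_count00_ge w (i + 1 + (j + 1))); lia.
Qed.

Lemma word_count_ge w : (size w <= n)%N ->
  lower_ge ((size w).+1%:Z + 1) (word_count w).
Proof.
rewrite -(size_map negb) => /word_count_le/lower_le_flip.
move/(_ _ _ (word_count_negb w)); rewrite size_map.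
by rewrite (_ : _ + _ - _ = (size w).+1%:Z + 1) //; lia.
Qed.

(** A down step after an excluded first element, or before an included last one, constrains nothing;
    so the count is the rank function of the inner fence, shifted by one. *)
Lemma end_count01_near m :
  (size m <= n)%N -> ~~ head false m -> ~~ last false m ->
  near_symmetric (size m).+1%:Z (end_count m false true).
Proof.
case: m => [|[] m] //.
case/lastP: m => [|m []] /=.
- by move=> _ _ _; split=> t lt_t i j /=; lia.
- by rewrite last_rcons.
rewrite size_rcons => lt_mn _ _.
have [|ge_m le_m] := IHn (w := m); first by lia.
have shift k : (end_count (rcons m false) false true k +
    end_count (rcons m false) true true k)%N = word_count m (k - 1).
  by rewrite !end_count_rcons /word_count /=; lia.
by split=> t lt_t i j lt_ij ij; rewrite !shift;
  [apply: (ge_m (t - 1 - 1)) | apply: (le_m (t - 1 - 1))]; lia.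
Qed.

End Step.

(** * Words with up runs at both ends *)

Section Padding.
Variables (a b : nat) (m : seq bool).
Let w := nseq a true ++ m ++ nseq b true.

Lemma size_padding : size w = (a + size m + b)%N.
Proof. by rewrite !size_cat !size_nseq addnA. Qed.

Lemma word_count_padding i j : i + j = (size w).+1%:Z ->
  (word_count w i + end_count m false true (j - b%:Z) =
   word_count w j + end_count m false true (i - b%:Z))%N.
Proof.
by move/word_count_center; rewrite /w !end_count_nseq !end_count_cat_nseq.
Qed.

(** For equal runs the shifted indices sum to [(size m).+1], so [word_count_center] for [m] trades
    its 01 counts for its rank numbers. *)
Lemma word_count_padding_eq i j : i + j = (size w).+1%:Z -> a = b ->
  (word_count w i + word_count m (j - a%:Z) =
   word_count w j + word_count m (i - a%:Z))%N.
Proof.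
move=> ij eq_ab; have := word_count_padding ij.
have := @word_count_center m (i - b%:Z) (j - b%:Z).
move: ij; rewrite size_padding eq_ab => ij; lia.
Qed.

Hypothesis m01_near : near_symmetric (size m).+1%:Z (end_count m false true).

(** The arguments [i - b] and [j - b] sum to [(size m).+1 + (a - b)], beyond the central index sum
    of the 01 count. *)
Lemma word_count_padding_gt : (b < a)%N ->
  lower_ge (size w).+1%:Z (word_count w).
Proof.
move=> lt_ba i j lt_ij ij; have := word_count_padding ij.
move: ij; rewrite size_padding => ij.
have := m01_near.1 (i - b%:Z + (j - b%:Z)) _ (i - b%:Z) (j - b%:Z); lia.
Qed.

Lemma word_count_padding_lt : (a < b)%N ->
  lower_le (size w).+1%:Z (word_count w).
Proof.
move=> lt_ba i j lt_ij ij; have := word_count_padding ij.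
move: ij; rewrite size_padding => ij.
have := m01_near.2 (i - b%:Z + (j - b%:Z)) _ (i - b%:Z) (j - b%:Z); lia.
Qed.

End Padding.

Lemma padding_decomposition w : exists (a : nat) m (b : nat),
  [/\ w = nseq a true ++ m ++ nseq b true, ~~ head false m & ~~ last false m].
Proof.
elim: w => [|[] w [a [m [b [-> m0 m1]]]]]; first by exists 0%N, [::], 0%N.
  by exists a.+1, m, b.
case: m a m0 m1 => [|u m] a m0 m1.
  by exists 0%N, [:: false], (a + b)%N; rewrite -nseqD.
by exists 0%N, (false :: nseq a true ++ u :: m), b; rewrite /= -catA last_cat.
Qed.

(** Shorter words give the comparisons at index sums [size w] and [size w + 2]; either direction at
    the sum in between then suffices. *)
Lemma word_count_interlaced w :
  interlaced (size w).+1%:Z (word_count w) \/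
  interlaced ((size w).+1%:Z + 1) (word_count w).
Proof.
have [n] := ubnP (size w); elim: n w => // n IHn w; rewrite ltnS => le_wn.
have near v : (size v < n)%N -> fence_near v.
  by move=> lt_vn; apply: interlaced_near; apply: IHn.
have reduce v : (size v <= n)%N ->
    lower_ge (size v).+1%:Z (word_count v) \/
    lower_le (size v).+1%:Z (word_count v) ->
    interlaced (size v).+1%:Z (word_count v) \/
    interlaced ((size v).+1%:Z + 1) (word_count v).
  move=> le_vn; have v_le := word_count_le near le_vn.
  have v_ge := word_count_ge near le_vn.
  case=> vN; [left | right]; split=> //; last by rewrite addrK.
  by rewrite (_ : _ - 1 = (size v)%:Z) //; lia.
have head_true v : (size v <= n)%N -> head true v ->
    lower_ge (size v).+1%:Z (word_count v) \/
    lower_le (size v).+1%:Z (word_count v).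
  have [a [m [b [-> m0 m1]]]] := padding_decomposition v => le_vn v0.
  have m01 : near_symmetric (size m).+1%:Z (end_count m false true).
    apply: (end_count01_near near) => //.
    by move: le_vn; rewrite size_padding; lia.
  have [lt_ab|lt_ba|eq_ab] := ltngtP a b.
  - by right; apply: word_count_padding_lt.
  - by left; apply: word_count_padding_gt.
  have := @word_count_padding_eq a b m; move: le_vn v0; rewrite size_padding.
  rewrite -eq_ab {b eq_ab}; case: a => [|a] le_vn v0 eqw.
    (* Empty runs leave only the empty word, which passes [head true] by the default value. *)
    case: m m0 v0 {m1 m01} le_vn eqw => [|[] m] //= _ _ _ eqw.
    by left=> i j _ ij; have := eqw i j ij erefl; rewrite /word_count /=; lia.
  have [|[_ m_ge]|[m_le _]] := IHn m _; first by lia.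
    left=> i j lt_ij ij; have := eqw i j ij erefl.
    have := m_ge (i - a.+1%:Z) (j - a.+1%:Z); lia.
  right=> i j lt_ij ij; have := eqw i j ij erefl.
  have := m_le (i - a.+1%:Z) (j - a.+1%:Z); lia.
(* The remaining words start with a down step; negating them reflects the comparison. *)
apply: (reduce) => //; case: w le_wn => [|[] w] le_wn; try exact: head_true.
have := head_true (map negb (false :: w)); rewrite size_map => /(_ le_wn isT).
set n1 := (size _).+1%:Z; have n1E : n1 = n1 + n1 - n1 by rewrite addrK.
have flip := word_count_negb (false :: w).
by case=> wN; [right | left]; rewrite n1E;
  [apply: (lower_ge_flip flip) | apply: (lower_le_flip flip)].
Qed.

Lemma word_count_near w : fence_near w.
Proof. exact/interlaced_near/word_count_interlaced. Qed.

End Words.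

(** * Ideals as bit vectors *)

Section IdealCount.
Implicit Types (w t : seq bool) (b : bool).

(* The characteristic vectors of the ideals of the fence with steps w whose
   membership at the first element is b. *)
Fixpoint ideal_bits w b : seq (seq bool) :=
  if w is u :: w' then
    map (cons b) (if b == u then ideal_bits w' false ++ ideal_bits w' true
                  else ideal_bits w' b)
  else [:: [:: b]].

Lemma count_ideal_bits w b (k : int) :
  count (fun t => (count id t)%:Z == k)%R (ideal_bits w b) =
  end_count w b false k + end_count w b true k.
Proof.
elim: w b k => [|u w IHw] b k; first by case: b => /=; lia.
rewrite /= count_map (eq_count (a2 := fun t =>
    (count id t)%:Z == if b then k - 1 else k)%R); last first.
  by move=> t /=; case: b; lia.
case: b u => [] [] /=; rewrite ?count_cat !IHw //; lia.
Qed.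

Lemma mem_ideal_bits w b t :
  reflect [/\ size t = (size w).+1, nth false t 0 = b &
           forall i, i < size w ->
             if nth true w i then nth false t i.+1 ==> nth false t i
             else nth false t i ==> nth false t i.+1]
          (t \in ideal_bits w b).
Proof.
elim: w b t => [|u w IHw] b t.
  rewrite inE; apply: (iffP eqP) => [-> //|]; case: t => [|c [|d t]] [] //= _ -> //.
apply: (iffP idP) => [/mapP[s s_in ->]|[]].
  have [c s_c bc] : exists2 c, s \in ideal_bits w c & (if u then c ==> b else b ==> c).
    by move: s_in; case: b u => [] [] /=; rewrite ?mem_cat => H;
       (case/orP: H => H || idtac); move: H; eauto.
  have [sz_s s0 s_w] := IHw _ _ s_c.
  by split=> /= [|//|[|i] lti /=]; [rewrite sz_s | rewrite s0; case: (u) bc | apply: s_w].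
case: t => [|c t] //= [sz_t] -> t_w.
apply: map_f; have t_in: t \in ideal_bits w (nth false t 0).
  by apply/IHw; split=> // i lti; apply: (t_w i.+1).
have := t_w 0 isT; rewrite /=.
by case: (u) b (nth _ _ _) t_in {t_w} => [] [] [] t_in //= _; rewrite mem_cat t_in ?orbT.
Qed.

Lemma ideal_bits_uniq w b : uniq (ideal_bits w b).
Proof.
elim: w b => [|u w IHw] b //=.
rewrite map_inj_uniq; last by move=> ? ? [].
case: ifP => _ //; rewrite cat_uniq !IHw andbT /=.
apply/hasPn => t /mem_ideal_bits[_ t0 _].
by apply/negP => /mem_ideal_bits[_]; rewrite t0.
Qed.

Variable alpha : seq nat.
Let w := fence_steps alpha.

Lemma size_fence_steps : size w = sumn alpha.
Proof. exact: size_steps_from. Qed.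

Lemma lower_idealP (I : {set fence alpha}) :
  reflect (forall x y, fence_gen y x -> x \in I -> y \in I) (lower_ideal I).
Proof.
apply: (iffP idP) => [/forall_inP idI x y yx xI | idI].
  by apply: (implyP (forallP (idI _ xI) y)); apply: connect1.
apply/forall_inP => x xI; apply/forallP => y; apply/implyP => /connectP[p].
elim: p y => [|z p IHp] y /= => [_ <- //|/andP[yz pz] def_x].
exact: idI yz (IHp z pz def_x).
Qed.

Definition ideal_of_bits t : {set fence alpha} :=
  [set x : fence alpha | nth false t (x : 'I_(sumn alpha).+1)].

Lemma card_ideal_of_bits t :
  size t = (sumn alpha).+1 -> #|ideal_of_bits t| = count id t.
Proof.
move=> sz_t; rewrite cardsE -sum1_card -sum1_count (big_nth false) sz_t big_mkord.
by apply: eq_bigl.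
Qed.

Lemma ideal_of_bits_inj t t' : size t = (sumn alpha).+1 ->
  size t' = (sumn alpha).+1 -> ideal_of_bits t = ideal_of_bits t' -> t = t'.
Proof.
move=> sz_t sz_t' /setP eq_t; apply: (@eq_from_nth _ false); first by rewrite sz_t.
move=> i; rewrite sz_t => lti; have := eq_t (Ordinal lti : fence alpha).
by rewrite !inE.
Qed.

Lemma ideal_of_bits_lower t : size t = (sumn alpha).+1 ->
  lower_ideal (ideal_of_bits t) = (t \in ideal_bits w (nth false t 0)).
Proof.
move=> sz_t; apply/lower_idealP/mem_ideal_bits => [idt | [_ _ t_w] x y].
  split=> [|//|i]; rewrite size_fence_steps // => lti.
  have ltSi : i.+1 < (sumn alpha).+1 by [].
  have := (idt (Ordinal ltSi) (Ordinal (ltnW ltSi)),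
           idt (Ordinal (ltnW ltSi)) (Ordinal ltSi)).
  rewrite /fence_gen !inE /= -/w; case: (nth true w i) => [[+ _]|[_ +]];
    by rewrite !eqxx ?orbT => /(_ isT)/implyP.
case: x y => [x ltx] [y lty]; rewrite /fence_gen !inE /= -/w.
case/orP=> /andP[/eqP def st].
  have := t_w y; rewrite size_fence_steps def in ltx * => /(_ ltx).
  by rewrite st => /implyP.
have := t_w x; rewrite size_fence_steps def in lty * => /(_ lty).
by rewrite (negPf st) => /implyP.
Qed.

(** [ideal_bits] lists the ideals without repetition and follows the recursion of [end_count]. *)
Lemma ideal_count_word (k : nat) :
  ideal_count (fence alpha) k = word_count w (k%:Z)%R.
Proof.
set B := ideal_bits w false ++ ideal_bits w true.
have szB t : t \in B -> size t = (sumn alpha).+1.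
  by rewrite -size_fence_steps mem_cat => /orP[] /mem_ideal_bits[].
have uniqB : uniq B.
  rewrite cat_uniq !ideal_bits_uniq andbT /=.
  apply/hasPn => t /mem_ideal_bits[_ t0 _].
  by apply/negP => /mem_ideal_bits[_]; rewrite t0.
have -> : word_count w (k%:Z)%R = count (fun t => count id t == k) B.
  transitivity (count (fun t => (count id t)%:Z == k%:Z)%R B).
    by rewrite count_cat !count_ideal_bits /word_count; lia.
  by apply: eq_count => t /=; lia.
rewrite -size_filter -(size_map ideal_of_bits) /ideal_count.
set s := map _ _; have /card_uniqP <- : uniq s.
  rewrite map_inj_in_uniq ?filter_uniq // => t t'.
  by rewrite !mem_filter => /andP[_ /szB szt] /andP[_ /szB szt']; apply: ideal_of_bits_inj.
apply: eq_card => I; rewrite inE; apply/idP/mapP => [/andP[idI cardI]|[t]].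
  pose t := mkseq (fun i => (inord i : fence alpha) \in I) (sumn alpha).+1.
  have szt : size t = (sumn alpha).+1 by rewrite size_mkseq.
  have defI : I = ideal_of_bits t.
    by apply/setP => x; rewrite inE nth_mkseq // inord_val.
  exists t => //; rewrite mem_filter -card_ideal_of_bits // -defI cardI /=.
  move: idI; rewrite defI ideal_of_bits_lower // mem_cat.
  by case: (nth _ _ _) => ->; rewrite ?orbT.
rewrite mem_filter => /andP[/eqP tk tB] ->; rewrite card_ideal_of_bits ?szB // tk eqxx andbT.
rewrite ideal_of_bits_lower ?szB //; move: tB; rewrite mem_cat.
by case/orP=> t_in; have /mem_ideal_bits[_ -> _] := t_in.
Qed.

End IdealCount.

(** With [i] and [m - i] as [p] and [q], in either order, each of the two families of links has a
    constant index sum. *)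
Lemma sorted_zigzagP (f p q : nat -> nat) n :
  reflect ((forall i, i.*2 < n -> f (p i) <= f (q i)) /\
           (forall i, i.*2.+1 < n -> f (q i) <= f (p i.+1)))
    (sorted leq (mkseq (fun j => f (if odd j then q j./2 else p j./2)) n.+1)).
Proof.
apply: (iffP (sortedP 0)) => [f_le | [f_pq f_qp] j].
  split=> i lt_in; [have := f_le i.*2 | have := f_le i.*2.+1];
    rewrite size_mkseq ltnS => /(_ lt_in); (rewrite !nth_mkseq; try lia);
    by rewrite /= odd_double /= ?uphalf_double doubleK.
rewrite size_mkseq ltnS => lt_jn; rewrite !nth_mkseq //=; last by lia.
rewrite uphalf_half; case: ifP => odd_j /=; last by apply: f_pq; lia.
by apply: f_qp; lia.
Qed.

(** * Rank sequences as values of [word_count] *)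

Section RankSeq.
Local Open Scope ring_scope.
Implicit Types (w : seq bool) (i j k : int).

Lemma end_count_lt0 w b c k : k < 0 -> end_count w b c k = 0%N.
Proof.
elim: w b k => [|u w IHw] b k k0; first by case: b c => [] [] /=; lia.
by rewrite /= !IHw; case: b; case: u => //=; lia.
Qed.

Lemma word_count_lt0 w k : k < 0 -> word_count w k = 0%N.
Proof. by move=> k0; rewrite /word_count !end_count_lt0. Qed.

Lemma word_count_gt w k : (size w).+1%:Z < k -> word_count w k = 0%N.
Proof. by move=> k_gt; rewrite -word_count_rev word_count_lt0; lia. Qed.

Lemma word_count_nseq a k : 0 <= k <= a.+1%:Z -> word_count (nseq a true) k = 1%N.
Proof.
suff up n l : (end_count (nseq n true) true false l +
    end_count (nseq n true) true true l = (1 <= l <= n.+1%:Z)%R)%N.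
  have out c : end_count (nseq a true) false c k = end_count [::] false c k.
    by rewrite -[nseq a true]cats0 end_count_nseq.
  move=> k_a; have := up a k; rewrite /word_count !out /=; lia.
elim: n l => [|n IHn] l /=; first by lia.
have out c : end_count (nseq n true) false c (l - 1) = end_count [::] false c (l - 1).
  by rewrite -[nseq n true]cats0 end_count_nseq.
by have := IHn (l - 1); rewrite !out /=; lia.
Qed.

(** By [word_count_interlaced], only the direction at the central index sum remains to be
    checked. *)
Lemma word_count_bottom w : lower_ge (size w).+1%:Z (word_count w) ->
  interlaced (size w).+1%:Z (word_count w).
Proof.
have [//|R_w] := word_count_interlaced w; split=> //.
by apply: (interlaced_le R_w); lia.
Qed.

Lemma word_count_top w : lower_le (size w).+1%:Z (word_count w) ->
  interlaced ((size w).+1%:Z + 1) (word_count w).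
Proof.
have [R_w|//] := word_count_interlaced w; split; first by rewrite addrK.
by apply: (interlaced_ge R_w); lia.
Qed.

Variable alpha : seq nat.
Let w := fence_steps alpha.

Lemma nth_rank_seq (k : nat) :
  (k <= (size w).+1)%N -> nth 0%N (rank_seq alpha) k = word_count w k%:Z.
Proof.
by rewrite size_fence_steps => le_k; rewrite nth_mkseq // ideal_count_word.
Qed.

Lemma size_rank_seq : size (rank_seq alpha) = (size w).+2.
Proof. by rewrite size_mkseq size_fence_steps. Qed.

Lemma symmetric_rank_seq : symmetric_seq (rank_seq alpha) <->
  forall i j, i + j = (size w).+1%:Z -> word_count w i = word_count w j.
Proof.
rewrite /symmetric_seq size_rank_seq /=; split=> [sym i j ij|sym k le_k].
  have [i0|i0] := ltP i 0; first by rewrite word_count_lt0 ?word_count_gt; lia.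
  have [j0|j0] := ltP j 0; first by rewrite word_count_gt ?word_count_lt0; lia.
  have := sym `|i|%N; rewrite !nth_rank_seq; try lia.
  have -> : `|i|%N%:Z = i by lia.
  have -> : ((size w).+1 - `|i|)%N%:Z = j by lia.
  by apply; lia.
by rewrite !nth_rank_seq; [apply: sym | |]; lia.
Qed.

Lemma bottom_rank_seq :
  reflect (interlaced (size w).+1%:Z (word_count w)) (bottom_interlacing (rank_seq alpha)).
Proof.
rewrite /bottom_interlacing size_rank_seq; cbv zeta.
apply: (iffP (sorted_zigzagP (nth 0%N (rank_seq alpha))
  (fun n => (size w).+1 - n)%N id (size w).+1)) => [[w_ge w_le]|[w_le w_ge]].
  split=> i j lt_ij ij; have [i0|i0] := ltP i 0.
  - by rewrite word_count_lt0.
  - have := w_le `|i|%N; rewrite !nth_rank_seq; try lia.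
    have -> : `|i|%N%:Z = i by lia.
    by have -> : ((size w).+1 - `|i|.+1)%N%:Z = j; [lia | apply; lia].
  - by rewrite word_count_gt; lia.
  have := w_ge `|i|%N; rewrite !nth_rank_seq; try lia.
  have -> : `|i|%N%:Z = i by lia.
  by have -> : ((size w).+1 - `|i|)%N%:Z = j; [lia | apply; lia].
by split=> i lt_i; rewrite !nth_rank_seq; try lia; [apply: w_ge | apply: w_le]; lia.
Qed.

Lemma top_rank_seq :
  reflect (interlaced ((size w).+1%:Z + 1) (word_count w)) (top_interlacing (rank_seq alpha)).
Proof.
rewrite /top_interlacing size_rank_seq; cbv zeta.
apply: (iffP (sorted_zigzagP (nth 0%N (rank_seq alpha))
  id (fun n => (size w).+1 - n)%N (size w).+1)) => [[w_le w_ge]|[w_le w_ge]].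
  split=> i j lt_ij ij.
    have [i0|i0] := ltP i 0; first by rewrite word_count_lt0.
    have := w_le `|i|%N; rewrite !nth_rank_seq; try lia.
    have -> : `|i|%N%:Z = i by lia.
    by have -> : ((size w).+1 - `|i|)%N%:Z = j; [lia | apply; lia].
  (* The index sum exceeds the last index by one, so already [i = 0] puts [j] past the end.
     Otherwise the pair is the link numbered [i - 1]. *)
  have [i0|i0] := ltP i 1; first by rewrite word_count_gt; lia.
  have := w_ge `|i|.-1; rewrite !nth_rank_seq; try lia.
  have -> : `|i|.-1.+1%:Z = i by lia.
  by have -> : ((size w).+1 - `|i|.-1)%N%:Z = j; [lia | apply; lia].
by split=> i lt_i; rewrite !nth_rank_seq; try lia; [apply: w_le | apply: w_ge]; lia.
Qed.

End RankSeq.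

(** * Step words of compositions, and the theorem *)

Lemma steps_from_cat up (s t : seq nat) :
  steps_from up (s ++ t) = steps_from up s ++ steps_from (up (+) odd (size s)) t.
Proof.
elim: s up => [|a s IHs] up /=; first by rewrite addbF.
by rewrite IHs catA addNb addbN.
Qed.

Lemma map_negb_steps_from up (s : seq nat) :
  map negb (steps_from up s) = steps_from (~~ up) s.
Proof. by elim: s up => //= a s IHs up; rewrite map_cat map_nseq IHs. Qed.

(** An odd number of alternating runs ends in the direction in which it starts. *)
Lemma steps_from_odd_ends (s : seq nat) : is_composition s -> odd (size s) ->
  ~~ head false (steps_from false s) /\ ~~ last false (steps_from false s).
Proof.
move=> s_comp odd_s; split; first by case: s s_comp {odd_s} => [|[|a] s].
case/lastP: s s_comp odd_s => [|s a] //; rewrite /is_composition all_rcons size_rcons.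
case/andP=> a_gt0 _ /= /negPf even_s; rewrite -cats1 steps_from_cat even_s /= cats0.
by rewrite last_cat; case: a a_gt0 => // a _; rewrite -addn1 nseqD cats1 last_rcons.
Qed.


Theorem theorem1p2 (alpha : seq nat) (halpha : is_composition alpha) :
  [/\ (* (a) *)
      size alpha = 1 ->
        rank_seq alpha = nseq (sumn alpha).+2 1 /\ symmetric_seq (rank_seq alpha),
      (* (b) *)
      ~~ odd (size alpha) -> bottom_interlacing (rank_seq alpha)
    & (* (c) *)
      odd (size alpha) -> 3 <= size alpha ->
      [/\ (* (i) *)
          nth 0 alpha 0 > nth 0 alpha (size alpha).-1 ->
            bottom_interlacing (rank_seq alpha),
          (* (ii) *)
          nth 0 alpha 0 < nth 0 alpha (size alpha).-1 ->
            top_interlacing (rank_seq alpha)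
        & (* (iii) *)
          nth 0 alpha 0 = nth 0 alpha (size alpha).-1 ->
          [/\ symmetric_seq (rank_seq (inner_parts alpha)) ->
                symmetric_seq (rank_seq alpha),
              top_interlacing (rank_seq (inner_parts alpha)) ->
                bottom_interlacing (rank_seq alpha)
            & bottom_interlacing (rank_seq (inner_parts alpha)) ->
                top_interlacing (rank_seq alpha)]]].
Proof.
split.
- case: alpha halpha => [|a [|//]] // _ _; set r := rank_seq _.
  have r1 : r = nseq (sumn [:: a]).+2 1.
    apply: (@eq_from_nth _ 0); rewrite size_mkseq ?size_nseq // => k lt_k.
    rewrite nth_nseq lt_k nth_rank_seq ?size_fence_steps // /fence_steps /= cats0.
    by rewrite word_count_nseq //; move: lt_k => /=; lia.
  split=> //; rewrite /symmetric_seq r1 size_nseq => k le_k.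
  by rewrite !nth_nseq !ifT //; lia.
- case: alpha halpha => [|a s] comp /= odd_s.
    apply/bottom_rank_seq/word_count_bottom => i j /=.
    by rewrite /word_count /=; lia.
  have [s0 s1] := steps_from_odd_ends (proj2 (andP comp)) (negbNE odd_s).
  apply/bottom_rank_seq/word_count_bottom.
  rewrite /fence_steps /= -[steps_from _ s]cats0.
  (* An even number of parts ends with a down run, so the final up run has length 0, less than
     [a]. *)
  apply: (@word_count_padding_gt a 0 (steps_from false s)).
    exact: (end_count01_near (fun v _ => word_count_near v)).
  by case/andP: comp.
case: alpha halpha => [|a s] // comp; case/lastP: s comp => [|s b] //.
rewrite /is_composition /= all_rcons => /and3P[a_gt0 b_gt0 s_comp].
rewrite size_rcons /= negbK => odd_s _.
rewrite nth_rcons ltnn eqxx.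
have -> : inner_parts (a :: rcons s b) = s.
  by rewrite /inner_parts /= size_rcons drop0 subSS subSS subn0 -cats1 take_size_cat.
set m := steps_from false s.
have def_w : fence_steps (a :: rcons s b) = nseq a true ++ m ++ nseq b true.
  by rewrite /fence_steps /= -cats1 steps_from_cat odd_s /= cats0.
have [m0 m1] := steps_from_odd_ends s_comp odd_s.
have m_near :=
  end_count01_near (fun v _ => word_count_near v) (leqnn _) m0 m1.
split.
- move=> lt_ba; apply/bottom_rank_seq/word_count_bottom; rewrite def_w.
  exact: word_count_padding_gt.
- move=> lt_ab; apply/top_rank_seq/word_count_top; rewrite def_w.
  exact: word_count_padding_lt.
move=> eq_ab.
(* Inside [alpha] the inner parts start downwards, so [m] describes the dual of [fence s]; this
   reflection is what exchanges top and bottom in (iii). *)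
have flip k : word_count m ((size m).+1%:Z - k)%R = word_count (fence_steps s) k.
  have -> : m = map negb (fence_steps s) by rewrite map_negb_steps_from.
  by rewrite size_map word_count_negb.
have size_m : size (fence_steps s) = size m by rewrite !size_steps_from.
have eq_w (i j : int) : (i + j = (size (fence_steps (a :: rcons s b))).+1%:Z)%R ->
    word_count (fence_steps (a :: rcons s b)) i + word_count (fence_steps s) (i - a%:Z)%R =
    word_count (fence_steps (a :: rcons s b)) j + word_count (fence_steps s) (j - a%:Z)%R.
  rewrite def_w -!flip => ij; have := word_count_padding_eq ij eq_ab.
  move: ij; rewrite size_padding -eq_ab => ij.
  have -> : ((size m).+1%:Z - (i - a%:Z) = j - a%:Z)%R by lia.
  by have -> : ((size m).+1%:Z - (j - a%:Z) = i - a%:Z)%R by lia.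
have size_w : size (fence_steps (a :: rcons s b)) = a + size m + a.
  by rewrite def_w size_padding -eq_ab.
split.
- move/symmetric_rank_seq => sym; apply/symmetric_rank_seq => i j ij.
  have := eq_w _ _ ij; have := sym (i - a%:Z)%R (j - a%:Z)%R; lia.
- move/top_rank_seq => [s_le _]; apply/bottom_rank_seq/word_count_bottom => i j lt_ij ij.
  have := eq_w _ _ ij; have := s_le (i - a%:Z)%R (j - a%:Z)%R; lia.
- move/bottom_rank_seq => [_ s_ge]; apply/top_rank_seq/word_count_top => i j lt_ij ij.
  have := eq_w _ _ ij; have := s_ge (i - a%:Z)%R (j - a%:Z)%R; lia.
Qed.
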